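(* Let $\mathcal A$ be an Archimedean $d$-algebra with a (not necessarily positive) multiplicative unit, let $a\in\mathcal A$ be an arbitrary element and let $i\in\{1,2\}$. Then $$\varphi\in\Phi_i(\mathcal A)\ \Longrightarrow\ a\varphi,\ \varphi a\in\Phi_i(\mathcal A).$$ In particular, $\Phi_i(\mathcal A)$ is a $d$-subalgebra and a ring ideal in $\mathcal A$. If additionally $\mathcal A$ is an $f$-algebra, then $\Phi_i(\mathcal A)$ is even an $f$-subalgebra.
   Context: An $\ell$-algebra is a real vector lattice $\mathcal A$ equipped with an associative (not necessarily commutative) bilinear multiplication such that $a,b\ge 0$ implies $ab\ge 0$. A $d$-algebra is an $\ell$-algebra in which $a\wedge b=0$ and $c\ge 0$ imply $(ac)\wedge(bc)=(ca)\wedge(cb)=0$. An $f$-algebra is an $\ell$-algebra in which $a\wedge b=0$ and $c\ge 0$ imply $(ac)\wedge b=(ca)\wedge b=0$. All vector lattices are Archimedean. A multiplicative unit is an element $e$ with $ae=ea=a$ for all $a$. Let $V$ be an Archimedean vector lattice with positive cone $V_+$. An element $\varphi\in V$ is finite if there is $z\in V_+$ such that for every $x\in V$ there is a number $c_x>0$ with $|x|\wedge n|\varphi|\le c_x z$ for all $n\in\mathbb N$; such a $z$ is called a majorant of $\varphi$. An element is totally finite if it has a majorant which is itself a finite element. $\Phi_1(V)$ and $\Phi_2(V)$ denote the sets of all finite and all totally finite elements of $V$, respectively; they are order ideals of $V$. A $d$-subalgebra (resp. $f$-subalgebra) is a vector sublattice closed under multiplication which is a $d$-algebra (resp. $f$-algebra)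 under the induced structure. A ring ideal is a two-sided ideal. *)

(* Defs.v *)
From HB Require Import structures.
From mathcomp Require Import all_boot all_order all_algebra.
From mathcomp Require Import boolp classical_sets reals.

Set Implicit Arguments.
Unset Strict Implicit.
Unset Printing Implicit Defensive.

Import Order.TTheory GRing.Theory Num.Theory.
Local Open Scope ring_scope.

(* Meet and join are fields over [porderZmodType], with the axioms of
   [Order.POrder_MeetJoin_isLattice]: the hierarchy of the library already joins
   order lattices and additive groups in [realDomainType] only, so a structure
   inheriting from both [latticeType] and [lmodType] cannot be declared. *)
HB.mixin Record isVectorLattice (R : realType) V
    of GRing.Lmodule R V & Num.POrderedZmodule V := {
  vmeet : V -> V -> V;
  vjoin : V -> V -> V;
  vmeetP : forall x y z : V, (x <= vmeet y z) = (x <= y) && (x <= z);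
  vjoinP : forall x y z : V, (vjoin x y <= z) = (x <= z) && (y <= z);
  vlat_leD2r : forall x y z : V, x <= y -> x + z <= y + z;
  vlat_scale_ge0 : forall (c : R) (x : V), 0 <= c -> 0 <= x -> 0 <= c *: x
}.

#[short(type="vectorLatticeType")]
HB.structure Definition VectorLattice (R : realType) :=
  { V of GRing.Lmodule R V & Num.POrderedZmodule V & isVectorLattice R V }.

HB.mixin Record isArchimedeanLattice (R : realType) V of VectorLattice R V := {
  vlat_archimedean : forall x y : V,
    0 <= x -> 0 <= y -> (forall n : nat, x *+ n <= y) -> x = 0
}.

#[short(type="archVectorLatticeType")]
HB.structure Definition ArchVectorLattice (R : realType) :=
  { V of VectorLattice R V & isArchimedeanLattice R V }.

(* The multiplication is the semigroup law [(x * y)%g]: the ring structures of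
   the library would force a multiplicative unit on every algebra, in
   particular on subalgebras. *)
HB.mixin Record isLatticeAlgebra (R : realType) A
    of VectorLattice R A & Semigroup A := {
  lalg_mulDl : forall x y z : A, ((x + y)%R * z)%g = (x * z)%g + (y * z)%g;
  lalg_mulDr : forall x y z : A, (x * (y + z)%R)%g = (x * y)%g + (x * z)%g;
  lalg_scaleAl : forall (c : R) (x y : A), ((c *: x) * y)%g = c *: (x * y)%g;
  lalg_scaleAr : forall (c : R) (x y : A), (x * (c *: y))%g = c *: (x * y)%g;
  lalg_mul_ge0 : forall x y : A, 0 <= x -> 0 <= y -> 0 <= (x * y)%g
}.

#[short(type="archLatticeAlgType")]
HB.structure Definition ArchLatticeAlgebra (R : realType) :=
  { A of ArchVectorLattice R A & Semigroup A & isLatticeAlgebra R A }.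

Section Algebras.
Variables (R : realType) (A : archLatticeAlgType R).

Definition d_algebra : Prop := forall a b c : A,
  vmeet a b = 0 -> 0 <= c ->
  vmeet (a * c)%g (b * c)%g = 0 /\ vmeet (c * a)%g (c * b)%g = 0.

Definition f_algebra : Prop := forall a b c : A,
  vmeet a b = 0 -> 0 <= c ->
  vmeet (a * c)%g b = 0 /\ vmeet (c * a)%g b = 0.

Definition mul_unit (e : A) : Prop :=
  forall a : A, (a * e)%g = a /\ (e * a)%g = a.

Record ring_ideal (S : set A) : Prop := RingIdeal {
  ring_ideal0 : S 0;
  ring_idealB : forall x y, S x -> S y -> S (x - y);
  ring_idealMl : forall a x, S x -> S (a * x)%g;
  ring_idealMr : forall a x, S x -> S (x * a)%g
}.

Record lattice_subalgebra (S : set A) : Prop := LatticeSubalgebra {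
  lsub0 : S 0;
  lsubD : forall x y, S x -> S y -> S (x + y);
  lsubZ : forall (c : R) x, S x -> S (c *: x);
  lsubI : forall x y, S x -> S y -> S (vmeet x y);
  lsubU : forall x y, S x -> S y -> S (vjoin x y);
  lsubM : forall x y, S x -> S y -> S (x * y)%g
}.

End Algebras.
Arguments d_algebra {R} A.
Arguments f_algebra {R} A.

Section FiniteElements.
Variables (R : realType) (V : archVectorLatticeType R).

Definition vabs (x : V) : V := vjoin x (- x).

Definition majorant (phi z : V) : Prop :=
  0 <= z /\ forall x : V, exists2 c : R, 0 < c &
    forall n : nat, vmeet (vabs x) (vabs phi *+ n) <= c *: z.

Definition finite_elements : set V :=
  [set phi | exists z, majorant phi z].

Definition totally_finite_elements : set V :=
  [set phi | exists2 z, majorant phi z & finite_elements z].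

End FiniteElements.
Arguments finite_elements {R} V.
Arguments totally_finite_elements {R} V.

(* [induced hS] is the subset [S] seen as an algebra of its own, with the
   restricted operations and order; [d_algebra (induced hS)] therefore quantifies
   over elements of [S] only. *)
Section Induced.
Variables (R : realType) (A : archLatticeAlgType R) (S : set A).

Definition induced (hS : lattice_subalgebra S) : Type := {x : A | x \in S}.

Variable hS : lattice_subalgebra S.
Notation T := (induced hS).

HB.instance Definition _ := [isSub of T for @sval A (fun x => x \in S)].
HB.instance Definition _ := [Choice of T by <:].

Definition ind_mk (x : A) (Sx : S x) : T := exist _ x (mem_set Sx).

Fact ind_mem (x : T) : S (val x).
Proof. exact: set_mem (valP x). Qed.

Fact ind_oppr_closed (x : A) : S x -> S (- x).
Proof. by move=> Sx; rewrite -scaleN1r; apply: lsubZ. Qed.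

Definition ind_zero : T := ind_mk (lsub0 hS).
Definition ind_add (x y : T) : T := ind_mk (lsubD hS (ind_mem x) (ind_mem y)).
Definition ind_opp (x : T) : T := ind_mk (ind_oppr_closed (ind_mem x)).
Definition ind_scale (c : R) (x : T) : T := ind_mk (lsubZ hS c (ind_mem x)).
Definition ind_meet (x y : T) : T := ind_mk (lsubI hS (ind_mem x) (ind_mem y)).
Definition ind_join (x y : T) : T := ind_mk (lsubU hS (ind_mem x) (ind_mem y)).
Definition ind_mul (x y : T) : T := ind_mk (lsubM hS (ind_mem x) (ind_mem y)).
Definition ind_le (x y : T) : bool := val x <= val y.

Fact ind_addA : associative ind_add.
Proof. by move=> x y z; apply: val_inj; apply: addrA. Qed.
Fact ind_addC : commutative ind_add.
Proof. by move=> x y; apply: val_inj; apply: addrC. Qed.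
Fact ind_add0 : left_id ind_zero ind_add.
Proof. by move=> x; apply: val_inj; apply: add0r. Qed.
Fact ind_addN : left_inverse ind_zero ind_opp ind_add.
Proof. by move=> x; apply: val_inj; apply: addNr. Qed.
HB.instance Definition _ :=
  GRing.isZmodule.Build T ind_addA ind_addC ind_add0 ind_addN.

Fact ind_scaleA (b c : R) (x : T) :
  ind_scale b (ind_scale c x) = ind_scale (b * c) x.
Proof. by apply: val_inj; apply: scalerA. Qed.
Fact ind_scale1 : left_id 1 ind_scale.
Proof. by move=> x; apply: val_inj; apply: scale1r. Qed.
Fact ind_scaleDr : right_distributive ind_scale +%R.
Proof. by move=> c x y; apply: val_inj; apply: scalerDr. Qed.
Fact ind_scaleDl (x : T) : {morph ind_scale^~ x : b c / b + c}.
Proof. by move=> b c; apply: val_inj; apply: scalerDl. Qed.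
HB.instance Definition _ :=
  GRing.Zmodule_isLmodule.Build R T ind_scaleA ind_scale1 ind_scaleDr
    ind_scaleDl.

Fact ind_le_refl : reflexive ind_le.
Proof. by move=> x; apply: lexx. Qed.
Fact ind_le_anti : antisymmetric ind_le.
Proof. by move=> x y lexy; apply/val_inj/le_anti. Qed.
Fact ind_le_trans : transitive ind_le.
Proof. by move=> y x z; apply: le_trans. Qed.
HB.instance Definition _ :=
  Order.Le_isPOrder.Build ring_display T ind_le_refl ind_le_anti ind_le_trans.

Fact ind_meetP (x y z : T) : (x <= ind_meet y z) = (x <= y) && (x <= z).
Proof. exact: vmeetP. Qed.
Fact ind_joinP (x y z : T) : (ind_join x y <= z) = (x <= z) && (y <= z).
Proof. exact: vjoinP. Qed.
Fact ind_leD2r (x y z : T) : x <= y -> x + z <= y + z.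
Proof. exact: vlat_leD2r. Qed.
Fact ind_scale_ge0 (c : R) (x : T) : 0 <= c -> 0 <= x -> 0 <= c *: x.
Proof. exact: vlat_scale_ge0. Qed.
HB.instance Definition _ :=
  isVectorLattice.Build R T ind_meetP ind_joinP ind_leD2r ind_scale_ge0.

Fact ind_archimedean (x y : T) :
  0 <= x -> 0 <= y -> (forall n : nat, x *+ n <= y) -> x = 0.
Proof.
move=> x0 y0 xy; apply: val_inj; apply: (@vlat_archimedean R A _ (val y) x0 y0) => n.
suff -> : val x *+ n = val (x *+ n) by exact: xy.
by elim: n => [//|n IHn]; rewrite !mulrS IHn.
Qed.
HB.instance Definition _ := isArchimedeanLattice.Build R T ind_archimedean.

Fact ind_mulA : associative ind_mul.
Proof. by move=> x y z; apply: val_inj; apply: mulgA. Qed.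
HB.instance Definition _ := isSemigroup.Build T ind_mulA.

Fact ind_mulDl (x y z : T) : ((x + y)%R * z)%g = (x * z)%g + (y * z)%g.
Proof. by apply: val_inj; apply: lalg_mulDl. Qed.
Fact ind_mulDr (x y z : T) : (x * (y + z)%R)%g = (x * y)%g + (x * z)%g.
Proof. by apply: val_inj; apply: lalg_mulDr. Qed.
Fact ind_scaleAl (c : R) (x y : T) : ((c *: x) * y)%g = c *: (x * y)%g.
Proof. by apply: val_inj; apply: lalg_scaleAl. Qed.
Fact ind_scaleAr (c : R) (x y : T) : (x * (c *: y))%g = c *: (x * y)%g.
Proof. by apply: val_inj; apply: lalg_scaleAr. Qed.
Fact ind_mul_ge0 (x y : T) : 0 <= x -> 0 <= y -> 0 <= (x * y)%g.
Proof. exact: lalg_mul_ge0. Qed.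
HB.instance Definition _ :=
  isLatticeAlgebra.Build R T ind_mulDl ind_mulDr ind_scaleAl ind_scaleAr
    ind_mul_ge0.

End Induced.

Definition d_subalgebra (R : realType) (A : archLatticeAlgType R)
    (S : set A) : Prop :=
  exists hS : lattice_subalgebra S, d_algebra (induced hS).

Definition f_subalgebra (R : realType) (A : archLatticeAlgType R)
    (S : set A) : Prop :=
  exists hS : lattice_subalgebra S, f_algebra (induced hS).

(* Main.v *)
Require Import Defs.
From mathcomp Require Import all_boot all_order all_algebra.
From mathcomp Require Import boolp classical_sets reals.

(** The point is that multiplication by [a] does not even change the majorant:
    every majorant of [phi] is one of [a * phi] and of [phi * a].

    In a [d]-algebra multiplication by a positive element preserves
    disjointness.  Applied to the disjoint parts [p], [q] of the unit
    [e = p - q], this forces [q = 0], so the unit is positive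
    ([d_algebra_unit_ge0]).  Multiplying a disjoint pair by [c + e] then shows
    that the algebra is an [f]-algebra ([unital_d_algebra_is_f]), and squares in
    an [f]-algebra are positive ([sqr_ge0]).

    For [a >= 0] and a scalar [s > 0], the inequality [(s a - e)^2 >= 0] gives
    [a <= s^-1 e + s a^2] ([le_unit_add_sqr]), whence, for arbitrary [a],
    [|a phi| <= s^-1 |phi| + s |a|^2 |phi|], and likewise on the other side.
    Thus [|a phi|] lies below multiples of [|phi|], up to an error that is an
    arbitrarily small multiple of one fixed element.  Such an error disappears
    from the inequality [|x| /\ n |a phi| <= c z], because the lattice is
    Archimedean; this is [majorant_dominated], and [majorantM] concludes.

    The same lemma, with error [0], shows that the finite elements and the
    totally finite elements are closed under passing to smaller absolute values;
    since majorants add up ([majorantD]), both sets are order ideals.  Together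
    with the stability under multiplication this makes them lattice subalgebras
    and ring ideals, and the disjointness conditions defining [d]- and
    [f]-algebras restrict to lattice subalgebras. *)

Set Implicit Arguments.
Unset Strict Implicit.
Unset Printing Implicit Defensive.

Import Order.TTheory GRing.Theory Num.Theory.
Local Open Scope ring_scope.

(** * Vector lattices *)

Section VectorLattices.
Variables (R : realType) (V : vectorLatticeType R).
Implicit Types (x y z w : V) (c d : R).

Lemma vsubr_ge0 x y : (0 <= y - x) = (x <= y).
Proof.
apply/idP/idP => [h|h].
  by have := vlat_leD2r _ _ x h; rewrite add0r subrK.
by have := vlat_leD2r _ _ (- x) h; rewrite subrr.
Qed.

Lemma vlerBlDr x y z : (x - y <= z) = (x <= z + y).
Proof. by rewrite -[LHS]vsubr_ge0 opprB addrA vsubr_ge0. Qed.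

Lemma vleD x y z w : x <= y -> z <= w -> x + z <= y + w.
Proof.
move=> xy zw; apply: (le_trans (vlat_leD2r _ _ z xy)).
by rewrite ![y + _]addrC; apply: vlat_leD2r.
Qed.

Lemma vaddr_ge0 x y : 0 <= x -> 0 <= y -> 0 <= x + y.
Proof. by move=> x0 y0; rewrite -[0]addr0; apply: vleD. Qed.

Lemma vle_muln n x y : x <= y -> x *+ n <= y *+ n.
Proof. by move=> xy; elim: n => // n IHn; rewrite !mulrS; apply: vleD. Qed.

Lemma vle_scale c x y : 0 <= c -> x <= y -> c *: x <= c *: y.
Proof.
move=> c0; rewrite -vsubr_ge0 => xy.
by rewrite -vsubr_ge0 -scalerBr; apply: vlat_scale_ge0.
Qed.

Lemma vle_scalel c d x : c <= d -> 0 <= x -> c *: x <= d *: x.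
Proof.
move=> cd x0; rewrite -vsubr_ge0 -scalerBl.
by apply: vlat_scale_ge0 => //; rewrite subr_ge0.
Qed.

Lemma vpmuln2_ge0 x : 0 <= x *+ 2 -> 0 <= x.
Proof.
move=> x0; have h0 : 0 <= 2^-1 :> R by rewrite invr_ge0 ler0n.
have := vlat_scale_ge0 _ _ h0 x0.
by rewrite -scaler_nat scalerA mulVf ?scale1r ?pnatr_eq0.
Qed.

Lemma vmeetl x y : vmeet x y <= x.
Proof. by have := lexx (vmeet x y); rewrite vmeetP => /andP[]. Qed.

Lemma vmeetr x y : vmeet x y <= y.
Proof. by have := lexx (vmeet x y); rewrite vmeetP => /andP[]. Qed.

Lemma vjoinl x y : x <= vjoin x y.
Proof. by have := lexx (vjoin x y); rewrite vjoinP => /andP[]. Qed.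

Lemma vjoinr x y : y <= vjoin x y.
Proof. by have := lexx (vjoin x y); rewrite vjoinP => /andP[]. Qed.

Lemma vmeetC x y : vmeet x y = vmeet y x.
Proof. by apply: le_anti; rewrite !vmeetP !vmeetl !vmeetr. Qed.

Lemma vmeetxx x : vmeet x x = x.
Proof. by apply: le_anti; rewrite vmeetl vmeetP lexx. Qed.

Lemma vmeet_idl x y : x <= y -> vmeet x y = x.
Proof. by move=> xy; apply: le_anti; rewrite vmeetl vmeetP lexx. Qed.

Lemma vmeet_mono x y z w : x <= y -> z <= w -> vmeet x z <= vmeet y w.
Proof.
move=> xy zw; rewrite vmeetP.
by rewrite (le_trans (vmeetl x z) xy) (le_trans (vmeetr x z) zw).
Qed.

Lemma vmeet_ge0 x y : 0 <= x -> 0 <= y -> 0 <= vmeet x y.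
Proof. by move=> x0 y0; rewrite vmeetP x0. Qed.

Lemma vmeetD_le x y z : 0 <= x -> 0 <= y -> 0 <= z ->
  vmeet x (y + z) <= vmeet x y + vmeet x z.
Proof.
move=> x0 y0 z0; rewrite -vlerBlDr vmeetP !vlerBlDr; apply/andP; split.
  rewrite -[leLHS]addr0; apply: vleD; [exact: vmeetl | exact: vmeet_ge0].
rewrite [leRHS]addrC -vlerBlDr vmeetP !vlerBlDr [z + y]addrC vmeetr andbT.
by rewrite -[leLHS]addr0; apply: vleD; first exact: vmeetl.
Qed.

Lemma disjoint_ge0 x y : vmeet x y = 0 -> 0 <= x /\ 0 <= y.
Proof. by move=> xy0; split; rewrite -xy0 ?vmeetl ?vmeetr. Qed.

Lemma disjoint_sub_ge0 x y : vmeet x y = 0 -> 0 <= x - y -> y = 0.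
Proof. by move=> xy0; rewrite vsubr_ge0 => /vmeet_idl <-; rewrite vmeetC. Qed.

Lemma disjoint_decomposition x :
  exists p q : V, vmeet p q = 0 /\ x = p - q.
Proof.
exists (vjoin x 0), (vjoin x 0 - x); split; last by rewrite opprB addrC subrK.
apply: le_anti; rewrite vmeet_ge0 ?vjoinr ?vsubr_ge0 ?vjoinl // andbT.
set m := vmeet _ _.
(* [x] and [0] are both below [vjoin x 0 - m], hence so is their join. *)
have : vjoin x 0 <= vjoin x 0 - m.
  rewrite vjoinP -vsubr_ge0 addrAC vsubr_ge0 vmeetr vsubr_ge0.
  exact: vmeetl.
by rewrite -vsubr_ge0 addrC addrA addNr add0r -sub0r vsubr_ge0.
Qed.

Lemma vopp_le x y : x <= y -> - y <= - x.
Proof. by rewrite -vsubr_ge0 => h; rewrite -vsubr_ge0 opprK addrC. Qed.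

Lemma vmeet_joinN x y : vmeet x y = - vjoin (- x) (- y).
Proof.
apply: le_anti; apply/andP; split.
  rewrite -[leLHS]opprK; apply: vopp_le.
  by rewrite vjoinP !vopp_le ?vmeetl ?vmeetr.
rewrite vmeetP; apply/andP; split; rewrite -[leRHS]opprK; apply: vopp_le.
  exact: vjoinl.
exact: vjoinr.
Qed.

End VectorLattices.

Section AbsoluteValue.
Variables (R : realType) (V : archVectorLatticeType R).
Implicit Types (x y : V) (c : R).

Lemma vabs_ge x : x <= vabs x. Proof. exact: vjoinl. Qed.

Lemma vabs_geN x : - x <= vabs x. Proof. exact: vjoinr. Qed.

Lemma vabs_le x y : (vabs x <= y) = (x <= y) && (- x <= y).
Proof. exact: vjoinP. Qed.

Lemma vabsN x : vabs (- x) = vabs x.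
Proof.
have half (u : V) : vabs (- u) <= vabs u.
  by rewrite vabs_le opprK vabs_ge vabs_geN.
by apply: le_anti; rewrite half; have := half (- x); rewrite opprK.
Qed.

Lemma vabs_ge0 x : 0 <= vabs x.
Proof.
apply: vpmuln2_ge0; rewrite mulr2n -(subrr x).
by apply: vleD; [exact: vabs_ge | exact: vabs_geN].
Qed.

Lemma vabs_id x : 0 <= x -> vabs x = x.
Proof.
move=> x0; apply: le_anti; rewrite vabs_ge vabs_le lexx andbT /=.
by apply: (le_trans _ x0); rewrite -vsubr_ge0 sub0r opprK.
Qed.

Lemma vabsD x y : vabs (x + y) <= vabs x + vabs y.
Proof. by rewrite vabs_le opprD !vleD ?vabs_ge ?vabs_geN. Qed.

Lemma vabsZ_le c x : vabs (c *: x) <= `|c| *: vabs x.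
Proof.
wlog c0 : c x / 0 <= c => [h|].
  have [c0|/ltW c0] := leP 0 c; first exact: h.
  rewrite -[x]opprK scalerN -scaleNr vabsN -normrN; apply: h.
  by rewrite oppr_ge0.
rewrite ger0_norm // vabs_le -scalerN.
by rewrite !vle_scale ?vabs_ge ?vabs_geN.
Qed.

Lemma vabs_join_le x y : vabs (vjoin x y) <= vabs x + vabs y.
Proof.
have xs : vabs x <= vabs x + vabs y by rewrite -[leLHS]addr0 vleD ?vabs_ge0.
have ys : vabs y <= vabs x + vabs y by rewrite -[leLHS]add0r vleD ?vabs_ge0.
rewrite vabs_le vjoinP (le_trans (vabs_ge x) xs) (le_trans (vabs_ge y) ys) /=.
exact: (le_trans (vopp_le (vjoinl x y)) (le_trans (vabs_geN x) xs)).
Qed.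

Lemma vabs_meet_le x y : vabs (vmeet x y) <= vabs x + vabs y.
Proof.
by rewrite vmeet_joinN vabsN -(vabsN x) -(vabsN y); apply: vabs_join_le.
Qed.

End AbsoluteValue.

(** * Finite elements *)

Section FiniteElements.
Variables (R : realType) (V : archVectorLatticeType R).
Implicit Types (x y z w phi psi : V).

Lemma arch_le x y w : 0 <= w ->
  (forall s : R, 0 < s -> x <= y + s *: w) -> x <= y.
Proof.
move=> w0 xys; rewrite -vsubr_ge0 -opprB -sub0r vsubr_ge0.
suff p0 : vjoin (x - y) 0 = 0 by rewrite -p0 vjoinl.
apply: (vlat_archimedean _ w (vjoinr _ _) w0) => -[|n]; first exact: w0.
have n0 : 0 < n.+1%:R :> R by rewrite ltr0n.
have pw : vjoin (x - y) 0 <= n.+1%:R^-1 *: w.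
  rewrite vjoinP vlerBlDr addrC xys ?invr_gt0 //=.
  by rewrite vlat_scale_ge0 // invr_ge0 ltW.
have := vle_scale (ltW n0) pw.
by rewrite scalerA divff ?gt_eqF // scale1r scaler_nat.
Qed.

(** The coefficient [c] of the error-free part may blow up as the error [s *: w]
    shrinks: it only changes the multiple of [vabs phi] that is met with
    [vabs x], and the bound given by a majorant is uniform in that multiple.  So
    [s] can go to [0] once [x] and [n] are fixed. *)
Lemma majorant_dominated phi psi z w : 0 <= w ->
  (forall s : R, 0 < s ->
     exists c : R, vabs psi <= c *: vabs phi + s *: w) ->
  majorant phi z -> majorant psi z.
Proof.
move=> w0 dom [z0 majz]; split=> // x; have [c c0 cz] := majz x.
exists c => // n; apply: (arch_le w0) => s s0.
have n0 : 0 < n.+1%:R :> R by rewrite ltr0n.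
have t0 : 0 < s / n.+1%:R by rewrite divr_gt0.
have [d psid] := dom _ t0; set k := Num.bound `|d|.
have dk : d <= k%:R.
  by rewrite (le_trans (ler_norm d)) // ltW // archi_boundP.
have psi_le : vabs psi *+ n <= vabs phi *+ (k * n) + s *: w.
  apply: (le_trans (vle_muln n psid)); rewrite mulrnDl; apply: vleD.
    rewrite mulrnA; apply: vle_muln; rewrite -scaler_nat.
    by apply: vle_scalel => //; apply: vabs_ge0.
  rewrite scalerMnl; apply: vle_scalel => //.
  rewrite -mulr_natr -mulrA ler_piMr ?(ltW s0) // mulrC ler_pdivrMr //.
  by rewrite mul1r ler_nat.
apply: (le_trans (vmeet_mono (lexx _) psi_le)).
apply: (le_trans (vmeetD_le _ _ _)); rewrite ?vabs_ge0 //.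
- by have := vle_muln (k * n) (vabs_ge0 phi); rewrite mul0rn.
- by rewrite vlat_scale_ge0 // ltW.
- by apply: vleD; [exact: cz | exact: vmeetr].
Qed.

Lemma majorant_solid phi psi z (c : R) :
  vabs psi <= c *: vabs phi -> majorant phi z -> majorant psi z.
Proof.
move=> psic; apply: (majorant_dominated (lexx 0)) => s _.
by exists c; rewrite scaler0 addr0.
Qed.

Lemma majorantD phi psi z w :
  majorant phi z -> majorant psi w -> majorant (phi + psi) (z + w).
Proof.
move=> [z0 phiz] [w0 psiw]; split=> [|x]; first exact: vaddr_ge0.
have [c c0 cz] := phiz x; have [d d0 dw] := psiw x.
exists (c + d) => [|n]; first exact: addr_gt0.
apply: (le_trans (vmeet_mono (lexx _) (vle_muln n (vabsD phi psi)))).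
rewrite mulrnDl; apply: (le_trans (vmeetD_le _ _ _)); rewrite ?vabs_ge0 //.
- by have := vle_muln n (vabs_ge0 phi); rewrite mul0rn.
- by have := vle_muln n (vabs_ge0 psi); rewrite mul0rn.
rewrite scalerDr; apply: vleD.
  apply: (le_trans (cz n)); apply: vle_scalel => //.
  by rewrite lerDl ltW.
apply: (le_trans (dw n)); apply: vle_scalel => //.
by rewrite lerDr ltW.
Qed.

Lemma majorant0 : majorant (0 : V) 0.
Proof.
split=> // x; exists 1 => // n.
by rewrite (vabs_id (lexx 0)) mul0rn scaler0 vmeetr.
Qed.

End FiniteElements.

Section MajorizedElements.
Variables (R : realType) (V : archVectorLatticeType R).

(** The two ideals are treated at once: both consist of the elements that have a
    majorant in a set closed under addition and containing [0], namely the whole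
    lattice, respectively the finite elements. *)
Definition majorized (M : set V) : set V :=
  [set phi | exists2 z, majorant phi z & M z].

Lemma finite_elementsE : finite_elements V = majorized setT.
Proof.
by apply/seteqP; split=> phi [z]; [exists z | exists z].
Qed.

Variable M : set V.
Hypotheses (M0 : M 0) (MD : forall y z, M y -> M z -> M (y + z)).
Local Notation Phi := (majorized M).

Lemma majorized_solid phi psi (c : R) :
  vabs psi <= c *: vabs phi -> Phi phi -> Phi psi.
Proof.
by move=> psic [z phiz Mz]; exists z => //; exact: majorant_solid psic phiz.
Qed.

Lemma majorized0 : Phi 0.
Proof. by exists 0 => //; apply: majorant0. Qed.

Lemma majorizedD phi psi : Phi phi -> Phi psi -> Phi (phi + psi).
Proof.
by move=> [y phiy My] [z psiz Mz]; exists (y + z);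
   [exact: majorantD | exact: MD].
Qed.

Lemma majorizedZ (c : R) phi : Phi phi -> Phi (c *: phi).
Proof. by apply: majorized_solid; apply: vabsZ_le. Qed.

Lemma majorizedB phi psi : Phi phi -> Phi psi -> Phi (phi - psi).
Proof.
move=> Pphi Ppsi; rewrite -scaleN1r.
by apply: majorizedD => //; apply: majorizedZ.
Qed.

Lemma majorized_absD phi psi : Phi phi -> Phi psi -> Phi (vabs phi + vabs psi).
Proof.
have abs (y : V) : Phi y -> Phi (vabs y).
  apply: (@majorized_solid _ _ 1).
  by rewrite scale1r (vabs_id (vabs_ge0 _)).
by move=> Pphi Ppsi; apply: majorizedD; apply: abs.
Qed.

Lemma majorized_meet phi psi : Phi phi -> Phi psi -> Phi (vmeet phi psi).
Proof.
move=> Pphi Ppsi; apply: (majorized_solid (c := 1)) (majorized_absD Pphi Ppsi).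
by rewrite scale1r; apply: (le_trans (vabs_meet_le _ _)); apply: vabs_ge.
Qed.

Lemma majorized_join phi psi : Phi phi -> Phi psi -> Phi (vjoin phi psi).
Proof.
move=> Pphi Ppsi; apply: (majorized_solid (c := 1)) (majorized_absD Pphi Ppsi).
by rewrite scale1r; apply: (le_trans (vabs_join_le _ _)); apply: vabs_ge.
Qed.

End MajorizedElements.

(** * Lattice-ordered algebras *)

Section LatticeAlgebras.
Variables (R : realType) (A : archLatticeAlgType R).
Implicit Types (a b c x y z phi : A).

Lemma amulNl x y : ((- x)%R * y)%g = - (x * y)%g.
Proof. by rewrite -scaleN1r lalg_scaleAl scaleN1r. Qed.

Lemma amulNr x y : (x * (- y)%R)%g = - (x * y)%g.
Proof. by rewrite -scaleN1r lalg_scaleAr scaleN1r. Qed.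

Lemma amulBl x y z : ((x - y)%R * z)%g = (x * z)%g - (y * z)%g.
Proof. by rewrite lalg_mulDl amulNl. Qed.

Lemma amulBr x y z : (z * (x - y)%R)%g = (z * x)%g - (z * y)%g.
Proof. by rewrite lalg_mulDr amulNr. Qed.

Lemma amul_lel x y z : 0 <= z -> x <= y -> (x * z)%g <= (y * z)%g.
Proof.
move=> z0; rewrite -vsubr_ge0 => xy.
by rewrite -vsubr_ge0 -amulBl; apply: lalg_mul_ge0.
Qed.

Lemma amul_ler x y z : 0 <= z -> x <= y -> (z * x)%g <= (z * y)%g.
Proof.
move=> z0; rewrite -vsubr_ge0 => xy.
by rewrite -vsubr_ge0 -amulBr; apply: lalg_mul_ge0.
Qed.

(** The sum of the positive products [(|x| - x) (|y| + y)] and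
    [(|x| + x) (|y| - y)] is twice [|x| |y| - x y]. *)
Lemma vabsM_le x y : vabs (x * y)%g <= (vabs x * vabs y)%g.
Proof.
have le_abs (u v : A) : (u * v)%g <= (vabs u * vabs v)%g.
  rewrite -vsubr_ge0; apply: vpmuln2_ge0.
  have subp (t : A) : 0 <= vabs t - t by rewrite vsubr_ge0 vabs_ge.
  have addp (t : A) : 0 <= vabs t + t.
    by rewrite -[t in _ + t]opprK vsubr_ge0 vabs_geN.
  have := vaddr_ge0 (lalg_mul_ge0 _ _ (subp u) (addp v))
                    (lalg_mul_ge0 _ _ (addp u) (subp v)).
  rewrite amulBl lalg_mulDl !lalg_mulDr !amulNr.
  move: (vabs u * vabs v)%g (vabs u * v)%g (u * vabs v)%g (u * v)%g => p q r s.
  suff -> : p + q - (r + s) + (p - q + (r - s)) = (p - s) *+ 2 by [].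
  have -> : p + q - (r + s) = (p - s) + (q - r).
    by rewrite opprD [- r - s]addrC addrACA.
  have -> : p - q + (r - s) = (p - s) + (r - q).
    by rewrite [r - s]addrC addrACA [- q + r]addrC.
  by rewrite mulr2n addrACA -(opprB q r) subrr addr0.
rewrite vabs_le le_abs -amulNl.
by apply: (le_trans (le_abs _ _)); rewrite vabsN.
Qed.

(** As [c + e] dominates both [c] and [e], the disjoint elements [a (c + e)] and
    [b (c + e)] dominate [a c] and [b e = b], which are thus disjoint too. *)
Lemma unital_d_algebra_is_f (e : A) :
  d_algebra A -> mul_unit e -> 0 <= e -> f_algebra A.
Proof.
move=> dA ue e0 a b c ab0 c0; have [a0 b0] := disjoint_ge0 ab0.
have ce0 : 0 <= c + e by apply: vaddr_ge0.
have cle : c <= c + e by rewrite -[leLHS]addr0 vleD.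
have ele : e <= c + e by rewrite -[leLHS]add0r vleD.
have [r l] := dA _ _ _ ab0 ce0.
have [be eb] := ue b.
by split; apply: le_anti; rewrite vmeet_ge0 ?lalg_mul_ge0 // andbT;
   [rewrite -r -{1}be | rewrite -l -{1}eb];
   apply: vmeet_mono; rewrite ?amul_lel ?amul_ler.
Qed.

(** Write [e = p - q] with [p] and [q] disjoint.  The positive elements
    [p = p p - p q] and [q = q p - q q] are differences of disjoint elements,
    so the subtracted parts [p q] and [q q] vanish; these are the two terms of
    [q = e q]. *)
Lemma d_algebra_unit_ge0 (e : A) : d_algebra A -> mul_unit e -> 0 <= e.
Proof.
move=> dA ue; have [p [q [pq0 epq]]] := disjoint_decomposition e.
have [p0 q0] := disjoint_ge0 pq0.
have mulq0 (u : A) : 0 <= u -> (u * q)%g = 0.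
  move=> u0; apply: (disjoint_sub_ge0 (dA _ _ _ pq0 u0).2).
  by rewrite -amulBr -epq (ue u).1.
have q_eq0 : q = 0.
  by rewrite -(ue q).2 epq amulBl !mulq0 // subrr.
by rewrite epq q_eq0 subr0.
Qed.

(** Multiplying first [x] by [y], then [y] by [x], turns the disjointness of [x]
    and [y] into that of [x y] with itself. *)
Lemma f_algebra_disjointM x y : f_algebra A -> vmeet x y = 0 -> (x * y)%g = 0.
Proof.
move=> fA xy0; have [x0 y0] := disjoint_ge0 xy0.
have := (fA _ _ _ xy0 y0).1; rewrite vmeetC => /fA/(_ x0)[_].
by rewrite vmeetxx.
Qed.

Lemma sqr_ge0 x : f_algebra A -> 0 <= (x * x)%g.
Proof.
move=> fA; have [p [q [pq0 ->]]] := disjoint_decomposition x.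
have [p0 q0] := disjoint_ge0 pq0.
have pq := f_algebra_disjointM fA pq0.
have qp : (q * p)%g = 0 by apply: f_algebra_disjointM; rewrite // vmeetC.
rewrite amulBl !amulBr pq qp.
by rewrite subr0 sub0r opprK; apply: vaddr_ge0; apply: lalg_mul_ge0.
Qed.

(** This is [(s a - e)^2 >= 0] divided by [s], which bounds [2 a], hence also
    [a] since [a >= 0]. *)
Lemma le_unit_add_sqr (e a : A) (s : R) :
  f_algebra A -> mul_unit e -> 0 <= a -> 0 < s ->
  a <= s^-1 *: e + s *: (a * a)%g.
Proof.
move=> fA ue a0 s0.
have sN0 : s != 0 by rewrite gt_eqF.
have [[aee _] [_ eea]] := (ue e, ue a).
have := sqr_ge0 (s *: a - e) fA.
rewrite amulBl !amulBr !lalg_scaleAl !lalg_scaleAr (ue a).1 eea aee.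
have sV0 : 0 <= s^-1 by rewrite invr_ge0 ltW.
move/(vlat_scale_ge0 _ _ sV0).
rewrite !scalerBr !scalerA mulrA mulVf // mul1r scale1r => h.
rewrite -vsubr_ge0; have := vaddr_ge0 h a0.
by rewrite opprB addrA subrK addrC addrA.
Qed.

(** The errors tolerated by [majorant_dominated] are here small multiples of
    [|a|^2 |phi|] and of [|phi| |a|^2]. *)
Lemma majorantM (e a phi z : A) : f_algebra A -> mul_unit e ->
  majorant phi z -> majorant (a * phi)%g z /\ majorant (phi * a)%g z.
Proof.
move=> fA ue phiz; set b := vabs a; have b0 : 0 <= b := vabs_ge0 a.
have p0 := vabs_ge0 phi.
have bb0 : 0 <= (b * b)%g by apply: lalg_mul_ge0.
split.
  apply: (majorant_dominated (w := (b * b * vabs phi)%g)) phiz => [|s s0].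
    exact: lalg_mul_ge0.
  exists s^-1; apply: (le_trans (vabsM_le a phi)).
  have := amul_lel p0 (le_unit_add_sqr fA ue b0 s0).
  by rewrite lalg_mulDl !lalg_scaleAl (ue _).2.
apply: (majorant_dominated (w := (vabs phi * (b * b))%g)) phiz => [|s s0].
  exact: lalg_mul_ge0.
exists s^-1; apply: (le_trans (vabsM_le phi a)).
have := amul_ler p0 (le_unit_add_sqr fA ue b0 s0).
by rewrite lalg_mulDr !lalg_scaleAr (ue _).1.
Qed.

Lemma induced_d_algebra (S : set A) (hS : lattice_subalgebra S) :
  d_algebra A -> d_algebra (induced hS).
Proof.
move=> dA a b c ab0 c0.
have [l r] := dA (val a) (val b) (val c) (congr1 val ab0) c0.
by split; apply: val_inj.
Qed.

Lemma induced_f_algebra (S : set A) (hS : lattice_subalgebra S) :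
  f_algebra A -> f_algebra (induced hS).
Proof.
move=> fA a b c ab0 c0.
have [l r] := fA (val a) (val b) (val c) (congr1 val ab0) c0.
by split; apply: val_inj.
Qed.

End LatticeAlgebras.

Theorem theorem3 (R : realType) (A : archLatticeAlgType R)
    (hA : d_algebra A) (e : A) (he : mul_unit e)
    (Phi : set A)
    (hPhi : Phi = finite_elements A \/ Phi = totally_finite_elements A) :
  (forall a phi : A, Phi phi -> Phi (a * phi)%g /\ Phi (phi * a)%g) /\
  (d_subalgebra Phi /\ ring_ideal Phi) /\
  (f_algebra A -> f_subalgebra Phi).
Proof.
have fA : f_algebra A.
  exact: (unital_d_algebra_is_f hA he (d_algebra_unit_ge0 hA he)).
have [M [M0 MD ->]] : exists M : set A,
    [/\ M 0, forall y z, M y -> M z -> M (y + z) & Phi = majorized M].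
  case: hPhi => ->.
    by exists setT; split=> //; apply: finite_elementsE.
  exists (finite_elements A); split=> //; rewrite finite_elementsE.
    exact: majorized0.
  by move=> y z; apply: majorizedD.
have PhiM a phi : majorized M phi ->
    majorized M (a * phi)%g /\ majorized M (phi * a)%g.
  case=> z phiz Mz; have [l r] := majorantM a fA he phiz.
  by split; exists z.
have hS : lattice_subalgebra (majorized M).
  split.
  - exact: majorized0.
  - exact: majorizedD.
  - exact: majorizedZ.
  - exact: majorized_meet.
  - exact: majorized_join.
  - by move=> x y _ /(PhiM x)[].
split=> //; split.
  split; first by exists hS; apply: induced_d_algebra.
  split; [exact: majorized0 | exact: majorizedB | |].
  - by move=> a x /(PhiM a)[].
  - by move=> a x /(PhiM a)[].
by move=> _; exists hS; apply: induced_f_algebra.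
Qed.
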